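(* Let $m\ge2$, $r\ge1$, let $\phi_1,\dots,\phi_r:\{0,\dots,m-1\}\to\mathbb{R}$, and let $\Phi:\Sigma_m^r\to\mathbb{R}$ be $\Phi(x^{(1)},\dots,x^{(r)})=\phi_1(x^{(1)}_1)\cdots\phi_r(x^{(r)}_1)$. For a probability vector $p=(p_0,\dots,p_{m-1})$ let $A(p)=\int_{\Sigma_m^r}\Phi\,d\mu_p^{\otimes r}$. Then $$A(p)=\prod_{k=1}^r\sum_{j=0}^{m-1}\phi_k(j)p_j,$$ and for any $\alpha$ with $E_\Phi(\alpha)\neq\emptyset$, $$h_{\rm top}(E_\Phi(\alpha))=\max_{A(p)=\alpha}H_1(p),$$ the maximum being over all probability vectors $p$ with $A(p)=\alpha$.
   Context: $\Sigma_m=\{0,\dots,m-1\}^{\mathbb{N}}$ with left shift $\sigma$; for $x\in\Sigma_m$, $x_1$ is its first coordinate. $\mu_p$ is the Bernoulli (product) measure on $\Sigma_m$ with marginal $p$, and $\mu_p^{\otimes r}$ the $r$-fold product. $H_1(p)=-\sum_{j=0}^{m-1}p_j\log p_j$ (with $0\log0=0$). $E_\Phi(\alpha)=\{x\in\Sigma_m:\lim_{n\to\infty}n^{-r}\sum_{1\le i_1,\dots,i_r\le n}\Phi(\sigma^{i_1}x,\dots,\sigma^{i_r}x)=\alpha\}$. $h_{\rm top}(Z)$ is Bowen's topological entropy of $Z\subset\Sigma_m$: with $d_n(x,y)=\max_{0\le j<n}d(\sigma^jx,\sigma^jy)$, $H^s_n(Z,\epsilon)=\inf\sum_ie^{-sn_i}$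 over countable covers of $Z$ by $d_{n_i}$-balls of radius $\epsilon$ with $n_i\ge n$, $H^s(Z,\epsilon)=\lim_nH^s_n(Z,\epsilon)$, $h_{\rm top}(Z,\epsilon)$ the critical $s$, $h_{\rm top}(Z)=\lim_{\epsilon\to0}h_{\rm top}(Z,\epsilon)$. *)

(* Defs.v *)
From HB Require Import structures.
From mathcomp Require Import all_boot all_order all_algebra.
From mathcomp Require Import all_classical all_reals all_analysis.
Set Implicit Arguments. Unset Strict Implicit. Unset Printing Implicit Defensive.
Import Order.TTheory GRing.Theory Num.Theory numFieldNormedType.Exports.
Local Open Scope classical_set_scope.
Local Open Scope ring_scope.

(* Alphabet {0,...,m-1}.  It is written 'I_(m.-1).+1, which is 'I_m for
   every m >= 1 (the theorem assumes m >= 2); the successor form makes the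
   type inhabited (needed for the measurable-space structure below). *)
Definition alph (m : nat) := 'I_(m.-1).+1.

(* Sigma_m = {0,...,m-1}^N ; coordinate x_1 of the paper is [x 0]. *)
Definition seqs (m : nat) := nat -> alph m.

Definition shift (m : nat) (x : seqs m) : seqs m := fun k => x k.+1.

Section Entropy.
Variables (R : realType) (m : nat).

Definition dist (x y : seqs m) : R :=
  match pselect (exists k, [pred k | x k != y k] k) with
  | left H => (m%:R ^- ex_minn H)
  | right _ => 0
  end.

Definition bowen_dist (n : nat) (x y : seqs m) : R :=
  \big[Num.max/0]_(j < n) dist (iter j (@shift m) x) (iter j (@shift m) y).

Definition bowen_ball (n : nat) (x : seqs m) (eps : R) : set (seqs m) :=
  [set y | bowen_dist n x y < eps].

(* A countable (possibly finite) family of Bowen balls B_{n_i}(x_i, eps) is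
   encoded as c : nat -> option (seqs m * nat), [Some (x_i, n_i)] being a
   ball and [None] an unused index. *)
Definition cover_ball (eps : R) (c : option (seqs m * nat)) : set (seqs m) :=
  match c with Some (x, k) => bowen_ball k x eps | None => set0 end.

Definition cover_term (s : R) (c : option (seqs m * nat)) : \bar R :=
  match c with Some (_, k) => (expR (- (s * k%:R)))%:E | None => 0%E end.

Definition is_cover (Z : set (seqs m)) (eps : R) (n : nat)
  (c : nat -> option (seqs m * nat)) : Prop :=
  (forall i x k, c i = Some (x, k) -> (n <= k)%N) /\
  Z `<=` \bigcup_i cover_ball eps (c i).

Definition bowenH_n (Z : set (seqs m)) (eps s : R) (n : nat) : \bar R :=
  ereal_inf [set (\sum_(0 <= i <oo) cover_term s (c i))%E
            | c in [set c | is_cover Z eps n c]].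

(* H^s(Z, eps) = lim_n H^s_n(Z, eps); the sequence is nondecreasing in n,
   so the limit is the supremum. *)
Definition bowenH (Z : set (seqs m)) (eps s : R) : \bar R :=
  ereal_sup [set bowenH_n Z eps s n | n in [set: nat]].

Definition htop_eps (Z : set (seqs m)) (eps : R) : \bar R :=
  ereal_inf [set s%:E | s in [set s : R | bowenH Z eps s = 0%E]].

(* h_top(Z) = lim_{eps -> 0} h_top(Z, eps); nonincreasing in eps, so this
   limit is the supremum over eps > 0. *)
Definition htop (Z : set (seqs m)) : \bar R :=
  ereal_sup [set htop_eps Z e | e in [set e : R | 0 < e]].

(* probability vectors and entropy H_1 (with 0 log 0 = 0, as ln 0 = 0) *)
Definition probvec (p : alph m -> R) : Prop :=
  (forall j, 0 <= p j) /\ \sum_(j : alph m) p j = 1.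

Definition H1 (p : alph m -> R) : R := - \sum_(j : alph m) p j * ln (p j).

End Entropy.

(* Sigma_m^r, with the sigma-algebra generated by cylinder sets (this is the
   Borel sigma-algebra of the product topology). *)
Definition conf (r m : nat) := 'I_r -> seqs m.
HB.instance Definition _ r m := gen_eqMixin (conf r m).
HB.instance Definition _ r m := gen_choiceMixin (conf r m).
HB.instance Definition _ r m :=
  isPointed.Build (conf r m) (fun _ _ => ord0).

Definition cyl (r m n : nat) (w : conf r m) : set (conf r m) :=
  [set y | forall (k : 'I_r) (i : nat), (i < n)%N -> y k i = w k i].

Definition cylinders (r m : nat) : set (set (conf r m)) :=
  [set A | exists (n : nat) (w : conf r m), A = cyl n w].

Definition conf_mes (r m : nat) := g_sigma_algebraType (@cylinders r m).

Definition bernoulli_prod (R : realType) (r m : nat) (p : alph m -> R)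
  (mu : set (conf_mes r m) -> \bar R) : Prop :=
  forall (n : nat) (w : conf r m),
    mu (cyl n w) = (\prod_(k < r) \prod_(i < n) p (w k i))%:E.

Definition Phi (R : realType) (r m : nat) (phi : 'I_r -> alph m -> R)
  (y : conf r m) : R := \prod_(k < r) phi k (y k 0%N).

Definition Elevel (R : realType) (r m : nat) (phi : 'I_r -> alph m -> R)
  (alpha : R) : set (seqs m) :=
  [set x : seqs m |
    (fun n : nat => (n%:R ^+ r)^-1 *
       \sum_(i : {ffun 'I_r -> 'I_n})
          Phi phi (fun k => iter (i k).+1 (@shift m) x)) @ \oo --> alpha].

Definition Aint (R : realType) (r m : nat) (phi : 'I_r -> alph m -> R)
  (mu : {measure set (conf_mes r m) -> \bar R}) : \bar R :=
  (\int[mu]_y (Phi phi y)%:E)%E.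

(* Main.v *)
(* Idea.  The Birkhoff average in [Elevel] factors as a product over [k] of the
   averages of [phi k] along [x], so [x] belongs to the level set iff the
   letter frequencies of its prefixes satisfy [level phi (freq n x) -> alpha].

   Upper bound: cover the level set by all cylinders of length [n >= N] whose
   frequency vector [q] nearly solves [level phi q = alpha].  A word has
   probability [exp (- n H1 q)] under its own frequency vector, so the words
   with a given vector are at most [exp (n H1 q)] many, and the number of
   vectors is polynomial in [n].  Compactness of the simplex makes [H1 q] at
   most the constrained maximum plus [eta].

   Lower bound, for [p] with [level phi p = alpha]: a Chernoff estimate gives
   the law of large numbers uniformly off a set [U] of small measure.  Off [U],
   points are in the level set and a cylinder of length [k] has mass at most
   [exp (- s k)] when [s < H1 p]; hence a cover of small weight together with
   [U] misses a point of the level set.  The Bernoulli measure is read off one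
   coordinate of the given product measure. *)
Require Import Defs.
From HB Require Import structures.
From mathcomp Require Import all_boot all_order all_algebra.
From mathcomp Require Import all_classical all_reals all_analysis.
From mathcomp Require Import ring lra.
Import Order.TTheory GRing.Theory Num.Theory numFieldNormedType.Exports.
Local Open Scope classical_set_scope.
Local Open Scope ring_scope.
Set Implicit Arguments. Unset Strict Implicit. Unset Printing Implicit Defensive.

(** * Elementary inequalities and continuity *)

Lemma expR_le_quadratic (R : realType) (x : R) :
  `|x| <= 1/2 -> expR x <= 1 + x + 2 * x ^+ 2.
Proof.
rewrite ler_norml => /andP[x1 x2].
have h : 0 < 1 - x by lra.
have e1 : 1 - x <= expR (- x) by have := expR_ge1Dx (- x).
have : expR x <= (1 - x)^-1.
  by rewrite -[expR x]invrK -expRN lef_pV2 ?posrE ?expR_gt0.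
(* Clearing the denominator leaves [x ^+ 2 * (1 - 2 * x) >= 0]. *)
move/le_trans; apply; rewrite -[_^-1]mul1r ler_pdivrMr //.
have := sqr_ge0 x; nra.
Qed.

Lemma continuous_xlnx (R : realType) : continuous (fun x : R => x * ln x).
Proof.
move=> x; have [x0|x0|->] := ltgtP x 0.
- rewrite /continuous_at (ln0 (ltW x0)) mulr0.
  apply: cvg_near_cst; near=> y.
  by rewrite ln0 ?mulr0 ?eqxx//; apply: ltW; near: y; exact: lt_nbhsl.
- by apply: cvgM; [exact: cvg_id | exact: continuous_ln].
rewrite /continuous_at mul0r.
(* Only continuity at 0 is delicate. With [s] the root of [y > 0], [ln s^-1 < s^-1] gives [- (y * ln
   y) = 2 * s ^+ 2 * (- ln s) <= 2 * s]; for [y <= 0] the convention [ln y = 0] settles it. *)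
have bnd (y : R) : `|y| < 1 -> `|y * ln y| <= 2 * Num.sqrt `|y|.
  move=> y1; have [y0|y0] := leP y 0.
    by rewrite ln0// mulr0 normr0 mulr_ge0// sqrtr_ge0.
  rewrite (gtr0_norm y0) in y1 *.
  set s := Num.sqrt y.
  have s0 : 0 < s by rewrite sqrtr_gt0.
  have ys : y = s ^+ 2 by rewrite sqr_sqrtr// ltW.
  have : ln s^-1 < s^-1 by rewrite ln_sublinear// invr_gt0.
  rewrite lnV ?posrE// => lns.
  rewrite normrM (gtr0_norm y0) ler0_norm; last by rewrite ln_le0// ltW.
  rewrite {1 2}ys lnXn// mulr2n.
  have : s * (- ln s) <= 1.
    by rewrite -ler_pdivlMl// mulr1 ltW.
  nra.
have g0 : (fun y : R => 2 * Num.sqrt `|y|) @ 0 --> (0 : R).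
  have e0 : 2 * Num.sqrt `|0 : R| = 0 by rewrite normr0 sqrtr0 mulr0.
  rewrite -[X in _ --> X]e0.
  apply: cvgM; first exact: cvg_cst.
  apply: (@continuous_cvg R R R _ _ (fun y => `|y|) Num.sqrt).
    exact: sqrt_continuous.
  by apply: cvg_norm; exact: cvg_id.
apply/cvgr0Pnorm_le => e e0'.
have g1 := (cvgr0Pnorm_le _).1 g0 e e0'.
near=> y; have y1 : `|y| < 1 by near: y; exact: cvgr0_norm_lt.
apply: le_trans (bnd y y1) _; apply: le_trans (ler_norm _) _.
by near: y; exact: g1.
Unshelve. all: by end_near. Qed.

Lemma cvg_bigsum (R : realType) (T : Type) (F : set_system T)
    {FF : Filter F} (I : Type) (r : seq I) (f : I -> T -> R) (l : I -> R) :
  (forall i, f i x @[x --> F] --> l i) ->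
  \sum_(i <- r) f i x @[x --> F] --> \sum_(i <- r) l i.
Proof.
move=> fl; elim: r => [|i r ih].
  by under eq_fun do rewrite big_nil; rewrite big_nil; exact: cvg_cst.
by under eq_fun do rewrite big_cons; rewrite big_cons; exact: cvgD.
Qed.

Lemma cvg_bigprod (R : realType) (T : Type) (F : set_system T)
    {FF : Filter F} (I : Type) (r : seq I) (f : I -> T -> R) (l : I -> R) :
  (forall i, f i x @[x --> F] --> l i) ->
  \prod_(i <- r) f i x @[x --> F] --> \prod_(i <- r) l i.
Proof.
move=> fl; elim: r => [|i r ih].
  by under eq_fun do rewrite big_nil; rewrite big_nil; exact: cvg_cst.
by under eq_fun do rewrite big_cons; rewrite big_cons; exact: cvgM.
Qed.

Lemma continuous_bigsum (R : realType) (T : topologicalType) (I : Type)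
    (r : seq I) (f : I -> T -> R) :
  (forall i, continuous (f i)) -> continuous (fun x => \sum_(i <- r) f i x).
Proof. by move=> cf x; apply: (@cvg_bigsum R T (nbhs x)) => i; exact: cf. Qed.

Lemma continuous_bigprod (R : realType) (T : topologicalType) (I : Type)
    (r : seq I) (f : I -> T -> R) :
  (forall i, continuous (f i)) -> continuous (fun x => \prod_(i <- r) f i x).
Proof. by move=> cf x; apply: (@cvg_bigprod R T (nbhs x)) => i; exact: cf. Qed.

(** * Compactness of the simplex and the constrained entropy maximum *)

Lemma compact_simplex (R : realType) (n : nat) :
  compact [set v : 'rV[R]_n.+1 |
    (forall j, 0 <= v ord0 j) /\ \sum_j v ord0 j = 1].
Proof.
set S := (X in compact X).
pose box := [set v : 'rV[R]_n.+1 | forall j, `[0, 1]%classic (v ord0 j)].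
pose sum1 := (fun v : 'rV[R]_n.+1 => \sum_j v ord0 j) @^-1` [set 1].
have -> : S = box `&` sum1.
  apply/seteqP; split=> v /=; last first.
    by move=> [b s]; split=> // j; have := b j; rewrite /= in_itv /= => /andP[].
  move=> [v0 v1]; split=> // j; rewrite /= in_itv /= v0 /= -v1 (bigD1 j)//=.
  by rewrite lerDl sumr_ge0.
apply: compact_closedI.
  by apply: (@rV_compact R _ (fun=> `[0, 1]%classic)) => i; exact: segment_compact.
apply: (@preimage_closed _ R (fun v : 'rV[R]_n.+1 => \sum_j v ord0 j)
  [set x | x = 1]); last exact: closed_eq.
by move=> v _; apply: continuous_bigsum => j; exact: coord_continuous.
Qed.

(** The distance to [a] attains its minimum on [D]. Read contrapositively, approximate solutions of
    [f x = a] in a compact set yield an exact one. *)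
Lemma compact_value_separated (R : realType) (T : topologicalType) (D : set T)
    (f : T -> R) (a : R) : compact D -> continuous f ->
  (forall x, D x -> f x <> a) ->
  exists2 d : R, 0 < d & forall x, D x -> d <= `|f x - a|.
Proof.
move=> cD cf fa; have [D0|/set0P/negP/negPn/eqP->] := pselect (D !=set0); last first.
  by exists 1.
have [|c] := @compact_EVT_min T R (fun x => `|f x - a|) D D0 cD.
  apply: continuous_subspaceT => x; apply: cvg_norm; apply: cvgB; last exact: cvg_cst.
  exact: cf.
rewrite inE => Dc cmin; exists `|f c - a|.
  by rewrite normr_gt0 subr_eq0; apply/eqP; exact: fa.
by move=> x Dx; apply: cmin; rewrite inE.
Qed.

Definition mean (R : realType) (m : nat) (p f : alph m -> R) : R :=
  \sum_j f j * p j.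

Definition level (R : realType) (r m : nat) (phi : 'I_r -> alph m -> R)
  (p : alph m -> R) : R := \prod_(k < r) mean p (phi k).

(* Existence of the maximum only needs [alpha] to be approximable; the last
   conjunct is the upper semicontinuity of the constrained maximum. *)
Lemma entropy_maximum (R : realType) (r m : nat) (phi : 'I_r -> alph m -> R)
    (alpha : R) :
  (forall d : R, 0 < d ->
     exists2 q : alph m -> R, probvec q & `|level phi q - alpha| < d) ->
  exists p : alph m -> R, [/\ probvec p, level phi p = alpha,
    forall q, probvec q -> level phi q = alpha -> H1 q <= H1 p &
    forall eta : R, 0 < eta -> exists2 d : R, 0 < d &
      forall q, probvec q -> `|level phi q - alpha| < d -> H1 q < H1 p + eta].
Proof.
move=> appr; pose fct (v : 'rV[R]_(m.-1).+1) : alph m -> R := fun j => v ord0 j.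
pose row (q : alph m -> R) : 'rV[R]_(m.-1).+1 := \row_j q j.
have fctK q : fct (row q) = q by apply/funext => j; rewrite /fct mxE.
pose S := [set v | probvec (fct v)].
have cS : compact S by exact: (@compact_simplex R m.-1).
have Srow q : probvec q -> S (row q) by rewrite /S /= fctK.
have cL : continuous (fun v => level phi (fct v)).
  apply: continuous_bigprod => k; apply: continuous_bigsum => j v.
  apply: (@continuousM R _ (fun=> phi k j) (fun v => fct v j)).
    exact: cst_continuous.
  exact: coord_continuous.
have cH : continuous (fun v => H1 (fct v)).
  suff cS' : continuous (fun v => \sum_j fct v j * ln (fct v j)).
    by move=> v; apply: (@continuousN _ R^o); exact: cS'.
  apply: continuous_bigsum => j v.
  apply: (@continuous_comp _ R R (fun v => fct v j) (fun x : R => x * ln x)).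
    exact: coord_continuous.
  exact: continuous_xlnx.
pose K := S `&` [set v | level phi (fct v) = alpha].
have clK : closed [set v | level phi (fct v) = alpha].
  apply: (@preimage_closed _ R (fun v => level phi (fct v)) [set x | x = alpha]).
    by move=> v _; exact: cL.
  exact: closed_eq.
have K0 : K !=set0.
  apply/not_existsP => noK.
  have [|d d0 dS] := @compact_value_separated _ _ S _ alpha cS cL.
    by move=> v Sv Av; apply: (noK v).
  have [q pq] := appr d d0; rewrite ltNge -(fctK q) => /negP; apply.
  by apply: dS; exact: Srow.
have [v] := compact_EVT_max K0 (compact_closedI cS clK) (continuous_subspaceT cH).
rewrite inE => -[Sv Av] vmax; exists (fct v); split=> //.
  move=> q pq qa; rewrite -(fctK q); apply: vmax.
  by rewrite inE; split; [exact: Srow|rewrite /= fctK].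
move=> eta eta0.
pose big := [set w | H1 (fct v) + eta <= H1 (fct w)].
have clbig : closed big.
  apply: (@preimage_closed _ R (fun w => H1 (fct w)) [set x | H1 (fct v) + eta <= x]).
    by move=> w _; exact: cH.
  exact: closed_ge.
(* The gap is taken on the vectors with entropy at least the maximum plus [eta]: they form a compact
   set on which [alpha] is never attained. *)
have [|d d0 dS] := @compact_value_separated _ _ _ _ alpha
    (compact_closedI cS clbig) cL.
  move=> w [Sw bw] Aw; have : H1 (fct w) <= H1 (fct v) by apply: vmax; rewrite inE.
  by move: bw; rewrite /big /=; lra.
exists d => // q pq; apply: contraTT; rewrite -!leNgt => qbig.
rewrite -(fctK q); apply: dS; split; first exact: Srow.
by rewrite /big /= fctK.
Qed.

(** * Words, cylinders and the Bernoulli measure *)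

(** The sum starts at coordinate 1 because the averages in [Elevel] run over the shifts 1 to [n]. *)
Definition bsum (R : realType) (m : nat) (f : alph m -> R) (n : nat)
  (x : seqs m) : R := \sum_(i < n) f (x i.+1).

Lemma nneseries_le (R : realType) (u : nat -> \bar R) (C : \bar R) :
  (forall i, 0 <= u i)%E -> (forall n, \sum_(0 <= i < n) u i <= C)%E ->
  (\sum_(0 <= i <oo) u i <= C)%E.
Proof.
move=> u0 uC; apply: lime_le; first by apply: is_cvg_nneseries => i _ _; exact: u0.
by apply: nearW => n; exact: uC.
Qed.

Lemma measure_bigsetU_le d (T : measurableType d) (R : realType)
    (mu : {measure set T -> \bar R}) (I : Type) (s : seq I) (P : pred I)
    (F : I -> set T) (a : I -> \bar R) :
  (forall i, P i -> measurable (F i)) -> (forall i, P i -> mu (F i) <= a i)%E ->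
  (mu (\big[setU/set0]_(i <- s | P i) F i) <= \sum_(i <- s | P i) a i)%E.
Proof.
move=> mF Fa.
have [//] : measurable (\big[setU/set0]_(i <- s | P i) F i) /\
  (mu (\big[setU/set0]_(i <- s | P i) F i) <= \sum_(i <- s | P i) a i)%E.
elim/big_ind2: _ => [|x A y B [mA xA] [mB yB]|i Pi].
- by rewrite measure0.
- split; first exact: measurableU.
  by apply: le_trans (measureU2 _ _ _) _ => //; exact: leeD.
- by split; [exact: mF|exact: Fa].
Qed.

Definition word (r m n : nat) (y : conf r m) : {ffun 'I_r * 'I_n -> alph m} :=
  [ffun ki : 'I_r * 'I_n => y ki.1 ki.2].

Definition word_ext (r m n : nat) (v : {ffun 'I_r * 'I_n -> alph m}) :
  conf r m := fun k i => if insub i is Some j then v (k, j) else ord0.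

Lemma cyl_word (r m n : nat) (v : {ffun 'I_r * 'I_n -> alph m}) (y : conf r m) :
  cyl n (word_ext v) y <-> word n y = v.
Proof.
split=> [yv|<- k i ilt].
  apply/ffunP => -[k i]; rewrite ffunE /= yv// /word_ext.
  by case: insubP => [j _ /val_inj ->//|]; rewrite ltn_ord.
rewrite /word_ext; case: insubP => [j _ /= ji|]; last by rewrite ilt.
by rewrite ffunE /= ji.
Qed.

(** Reduces events on finitely many coordinates to cylinders, which generate the sigma-algebra and
    are the sets whose mass [bernoulli_prod] prescribes. *)
Lemma word_eventE (r m n : nat) (P : pred {ffun 'I_r * 'I_n -> alph m}) :
  [set y | P (word n y)] =
  \big[setU/set0]_(v | P v) cyl n (word_ext v).
Proof.
rewrite -bigcup_seq_cond; apply/seteqP; split=> y /=.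
  by move=> Py; exists (word n y); [rewrite /= mem_index_enum|exact/cyl_word].
by move=> [v /= /andP[_ Pv]] /cyl_word ->.
Qed.

Lemma measurable_cyl (r m n : nat) (w : conf r m) :
  measurable (cyl n w : set (conf_mes r m)).
Proof. by apply: sub_sigma_algebra; exists n, w. Qed.

Lemma measurable_word_event (r m n : nat)
    (P : pred {ffun 'I_r * 'I_n -> alph m}) :
  measurable ([set y | P (word n y)] : set (conf_mes r m)).
Proof.
by rewrite word_eventE; apply: bigsetU_measurable => v _; exact: measurable_cyl.
Qed.

Section BernoulliProduct.
Variables (R : realType) (r m : nat) (p : alph m -> R).
Variable mu : {measure set (conf_mes r m) -> \bar R}.
Hypothesis pP : probvec p.
Hypothesis mup : bernoulli_prod p mu.

Lemma bernoulli_word n (v : {ffun 'I_r * 'I_n -> alph m}) :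
  mu (cyl n (word_ext v)) = (\prod_ki p (v ki))%:E.
Proof.
rewrite mup; congr EFin; rewrite pair_big /=; apply: eq_bigr => -[k i] _ /=.
by rewrite /word_ext; case: insubP => [j _ /val_inj ->//|]; rewrite ltn_ord.
Qed.

Lemma bernoulli_setT : mu setT = 1%E.
Proof.
have -> : [set: conf_mes r m] = cyl 0 (fun _ _ => ord0) by apply/seteqP; split.
by rewrite mup big1// => k _; rewrite big_ord0.
Qed.

Lemma bernoulli_word_event n (P : pred {ffun 'I_r * 'I_n -> alph m}) :
  (mu [set y | P (word n y)] <= (\sum_(v | P v) \prod_ki p (v ki))%:E)%E.
Proof.
rewrite word_eventE -sumEFin; apply: measure_bigsetU_le => v _.
  exact: measurable_cyl.
by rewrite bernoulli_word.
Qed.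

(* Markov's inequality for a product weight read along the coordinate [k0]. *)
Lemma bernoulli_markov (k0 : 'I_r) n (g : nat -> alph m -> R) :
  (forall i j, 0 <= g i j) ->
  let S : set (conf_mes r m) := [set y | 1 <= \prod_(i < n) g i (y k0 i)] in
  measurable S /\ (mu S <= (\prod_(i < n) \sum_j p j * g i j)%:E)%E.
Proof.
move=> g0 S; have [p0 p1] := pP.
pose P (v : {ffun 'I_r * 'I_n -> alph m}) := 1 <= \prod_(i < n) g i (v (k0, i)).
have -> : S = [set y | P (word n y)].
  apply/funext => y; rewrite /S /P /=.
  by under [in RHS]eq_bigr do rewrite ffunE.
split; first exact: measurable_word_event.
apply: le_trans (bernoulli_word_event _) _; rewrite lee_fin.
have coord (F : 'I_r * 'I_n -> R) : (forall ki, ki.1 != k0 -> F ki = 1) ->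
    \prod_ki F ki = \prod_(i < n) F (k0, i).
  move=> F1; transitivity (\prod_k \prod_i F (k, i)).
    by rewrite pair_bigA /=; apply: eq_bigr => -[].
  rewrite (bigD1 k0)//= [X in _ * X]big1 ?mulr1//.
  by move=> k kk0; rewrite big1// => i _; rewrite F1.
(* [G] extends [g] by 1 to the rows other than [k0], whose letter sums are then 1; distributivity
   turns the product of sums into a sum over words. *)
pose G (ki : 'I_r * 'I_n) j := if ki.1 == k0 then g ki.2 j else 1.
have -> : \prod_(i < n) \sum_j p j * g i j =
    \sum_(v : {ffun 'I_r * 'I_n -> alph m}) \prod_ki (p (v ki) * G ki (v ki)).
  rewrite -(bigA_distr_bigA (fun ki j => p j * G ki j)) coord.
    by apply: eq_bigr => i _; apply: eq_bigr => j _; rewrite /G /= eqxx.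
  by move=> ki /negPf kk0; under eq_bigr do rewrite /G kk0 mulr1.
have nn (v : {ffun 'I_r * 'I_n -> alph m}) : 0 <= \prod_ki (p (v ki) * G ki (v ki)).
  apply: prodr_ge0 => ki _; rewrite mulr_ge0// /G; by case: ifP.
(* Words outside [P] contribute nonnegative terms; on [P] the additional factor is at least 1. *)
rewrite [leRHS](bigID P)/= -[leLHS]addr0 lerD ?sumr_ge0//.
apply: ler_sum => v Pv; rewrite big_split /= ler_peMr ?prodr_ge0//.
rewrite coord; last by move=> ki /negPf; rewrite /G => ->.
by under eq_bigr do rewrite /G eqxx.
Qed.

End BernoulliProduct.

(** [Phi] reads only first letters, so it is constant on cylinders of length 1; its integral is a
    finite sum over words, which factors over the rows. *)
Lemma Aint_level (R : realType) (r m : nat) (phi : 'I_r -> alph m -> R)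
    (p : alph m -> R) (mu : {measure set (conf_mes r m) -> \bar R}) :
  probvec p -> bernoulli_prod p mu -> Aint phi mu = (level phi p)%:E.
Proof.
move=> pP mup; pose W := {ffun 'I_r * 'I_1 -> alph m}.
pose F (v : W) : set (conf_mes r m) := cyl 1 (word_ext v).
pose c (v : W) : R := \prod_(k < r) phi k (v (k, ord0)).
have Phic (y : conf r m) : Phi phi y = c (word 1 y).
  by apply: eq_bigr => k _; rewrite ffunE.
have DT : \big[setU/set0]_(v : W) F v = setT.
  by rewrite -(word_eventE xpredT); apply/seteqP; split.
rewrite /Aint -DT integral_bigsetU_EFin; first last.
- rewrite DT => _ Y mY; rewrite setTI.
  have -> : (EFin \o Phi phi) @^-1` Y = [set y | `[< Y (c (word 1 y))%:E >]].
    by apply/seteqP; split=> y /=; rewrite Phic => /asboolP.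
  exact: (measurable_word_event (fun v : W => `[< Y (c v)%:E >])).
- by move=> v w _ _ [y [/cyl_word <- /cyl_word <-]].
- exact: index_enum_uniq.
- by move=> v; exact: measurable_cyl.
transitivity (\sum_(v : W) (c v * \prod_ki p (v ki))%:E)%E.
  apply: eq_bigr => v _.
  rewrite (@eq_integral _ _ _ mu (F v) (cst (c v)%:E)).
    by rewrite integral_cst ?(bernoulli_word mup)//; exact: measurable_cyl.
  by move=> y; rewrite inE => /cyl_word <-; rewrite Phic.
rewrite sumEFin; congr EFin.
transitivity (\sum_(v : W) \prod_ki (phi ki.1 (v ki) * p (v ki))).
  apply: eq_bigr => v _; rewrite big_split /=; congr (_ * _).
  transitivity (\prod_(k < r) \prod_(i < 1) phi k (v (k, i))).
    by apply: eq_bigr => k _; rewrite big_ord1.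
  by rewrite pair_bigA; apply: eq_bigr => -[].
rewrite -(bigA_distr_bigA (fun (ki : 'I_r * 'I_1) j => phi ki.1 j * p j)).
rewrite -(pair_bigA _ (fun k (_ : 'I_1) => mean p (phi k))) /=.
by apply: eq_bigr => k _; rewrite big_ord1.
Qed.

(** * Chernoff estimate and a uniform law of large numbers *)

(** As a function of [t] the sum is 1 at 0 with slope [- e]. If [B] bounds the values [c j], it is
    at most [1 - t * e + 2 * (t * B) ^+ 2], which is [1 - t * e / 2] for [t = e / (4 * B ^+ 2)]. *)
Lemma chernoff_rate (R : realType) (m : nat) (p f : alph m -> R) (e : R) :
  probvec p -> 0 < e -> exists2 t : R, 0 < t &
    \sum_j p j * expR (t * (f j - (mean p f + e))) < 1.
Proof.
move=> pP e0; have [p0 p1] := pP.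
pose c j := f j - (mean p f + e).
(* The summand [1 + e] forces [t * B = e / (4 * B) < 1/4] for the [t] chosen below, within the range
   of [expR_le_quadratic]. *)
pose B := 1 + e + \sum_j `|c j|.
have B1 : 1 + e <= B by rewrite lerDl sumr_ge0.
have cB j : `|c j| <= B.
  have : `|c j| <= \sum_j `|c j| by rewrite [leRHS](bigD1 j)//= lerDl sumr_ge0.
  by rewrite /B; lra.
exists (e / (4 * B ^+ 2)); first by rewrite divr_gt0// mulr_gt0// exprn_gt0//; lra.
set t := e / _.
have tB : t * B ^+ 2 = e / 4 by rewrite /t; field; apply/negP; lra.
have t0 : 0 < t by rewrite divr_gt0// mulr_gt0// exprn_gt0//; lra.
apply: (@le_lt_trans _ _ (\sum_j p j * (1 + t * c j + 2 * (t * B) ^+ 2))).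
  apply: ler_sum => j _; apply: ler_wpM2l => //.
  apply: le_trans (expR_le_quadratic _) _.
    rewrite normrM (gtr0_norm t0).
    apply: (@le_trans _ _ (t * B)); first by apply: ler_wpM2l; [exact: ltW|exact: cB].
    have tBB : t * B * B = e / 4 by rewrite -mulrA -expr2.
    nra.
  rewrite -/(c j) lerD2l ler_pM2l// [(t * c j) ^+ 2]exprMn [(t * B) ^+ 2]exprMn.
  rewrite ler_pM2l ?exprn_gt0//.
  by rewrite -real_normK ?num_real// ler_pXn2r// nnegrE; lra.
have sumE : \sum_j p j * (1 + t * c j + 2 * (t * B) ^+ 2) =
    1 - t * e + 2 * (t * B) ^+ 2.
  transitivity ((1 + 2 * (t * B) ^+ 2) * (\sum_j p j) + t * mean p f
      - t * (mean p f + e) * (\sum_j p j)); last by rewrite p1; ring.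
  have -> : t * mean p f = \sum_j t * (f j * p j) by rewrite -mulr_sumr.
  rewrite !mulr_sumr -big_split -sumrB /=; apply: eq_bigr => j _.
  by rewrite /c; ring.
rewrite sumE.
have -> : (t * B) ^+ 2 = t * (e / 4) by rewrite exprMn expr2 -mulrA tB.
nra.
Qed.

Section LawOfLargeNumbers.
Variables (R : realType) (r m : nat) (p : alph m -> R) (k0 : 'I_r).
Variable mu : {measure set (conf_mes r m) -> \bar R}.
Hypothesis pP : probvec p.
Hypothesis mup : bernoulli_prod p mu.

(** Failure at time [n] has mass at most [rho ^+ n]; [U] collects the failures from time [N] on, a
    geometric tail. *)
Lemma upper_lln_fixed (f : alph m -> R) (e eta : R) : 0 < e -> 0 < eta ->
  exists (U : set (conf_mes r m)) (N : nat), [/\ measurable U,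
    (mu U <= eta%:E)%E & forall y n, ~ U y -> (N <= n)%N ->
      bsum f n (y k0) <= n%:R * (mean p f + e)].
Proof.
move=> e0 eta0; have [p0 p1] := pP.
have [t t0] := chernoff_rate f pP e0; set rho := \sum_j _ => rho1.
have rho0 : 0 <= rho by apply: sumr_ge0 => j _; rewrite mulr_ge0// expR_ge0.
pose s := (rho + 1) / 2.
have s0 : 0 < s by rewrite /s; lra.
have s1 : s < 1 by rewrite /s; lra.
have rhos : rho <= s by rewrite /s; lra.
have ns1 : `|s| < 1 by rewrite gtr0_norm.
(* Coordinate 0 gets the factor 1, so the product over [n.+1] coordinates sees exactly the letters
   of [bsum f n]. *)
pose g (i : nat) (j : alph m) : R :=
  if i is 0 then 1 else expR (t * (f j - (mean p f + e))).
have g0 i j : 0 <= g i j by case: i => [|i] //=; exact: expR_ge0.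
pose Bad n : set (conf_mes r m) := [set y | 1 <= \prod_(i < n.+1) g i (y k0 i)].
have mBad n : measurable (Bad n) by have [] := bernoulli_markov pP mup k0 n.+1 g0.
have muBad n : (mu (Bad n) <= (s ^+ n)%:E)%E.
  have [_] := bernoulli_markov pP mup k0 n.+1 g0; move/le_trans; apply.
  rewrite lee_fin big_ord_recl /=; under eq_bigr do rewrite mulr1.
  by rewrite p1 mul1r prodr_const card_ord lerXn2r ?nnegrE// ltW.
have BadP n (y : conf_mes r m) :
    ~ Bad n y -> bsum f n (y k0) <= n%:R * (mean p f + e).
  move=> /negP; apply: contraNT; rewrite -ltNge => lt_sum.
  rewrite /Bad /= big_ord_recl mul1r /= -expR_sum -expR0 ler_expR -mulr_sumr.
  rewrite pmulr_rge0// sumrB sumr_const card_ord subr_ge0 -mulr_natl ltW//.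
have [N Nsmall] : exists N, s ^+ N / (1 - s) <= eta.
  have c0 : 0 < eta * (1 - s) by rewrite mulr_gt0// subr_gt0.
  have [N _ /(_ N (leqnn N))] := (cvgr0Pnorm_le _).1 (@cvg_geometric R 1 s ns1) _ c0.
  rewrite /= mul1r ger0_norm ?exprn_ge0 ?(ltW s0)// => sN.
  by exists N; rewrite ler_pdivrMr// subr_gt0.
exists (\bigcup_n Bad (N + n)%N), N; split.
- by apply: bigcup_measurable => n _; exact: mBad.
- apply: le_trans (measure_sigma_subadditive (F := fun n => Bad (N + n)%N) _ _ _ _) _ => //.
    by apply: bigcup_measurable => n _; exact: mBad.
  apply: nneseries_le => // n.
  apply: (@le_trans _ _ (\sum_(0 <= i < n) (s ^+ N * s ^+ i)%:E)%E).
    by apply: lee_sum => i _; rewrite -exprD; exact: muBad.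
  rewrite sumEFin lee_fin; apply: le_trans Nsmall.
  by apply: geometric_le_lim => //; rewrite exprn_ge0// ltW.
- move=> y n nU Nn; apply: BadP => yBad; apply: nU; exists (n - N)%N => //.
  by rewrite subnKC.
Qed.

(* Egorov-type form: off one small set, for every tolerance [e]. *)
Lemma upper_lln (f : alph m -> R) (eta : R) : 0 < eta ->
  exists U : set (conf_mes r m), [/\ measurable U, (mu U <= eta%:E)%E &
    forall e : R, 0 < e -> exists N : nat, forall y n, ~ U y -> (N <= n)%N ->
      bsum f n (y k0) <= n%:R * (mean p f + e)].
Proof.
move=> eta0.
(* The masses [eta / 2 ^ k.+1] add up to [eta], and every [e] exceeds some tolerance
   [k.+1%:R^-1]. *)
have H k : exists UN : set (conf_mes r m) * nat, [/\ measurable UN.1,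
    (mu UN.1 <= (eta / (2 ^ k.+1)%:R)%:E)%E & forall y n, ~ UN.1 y -> (UN.2 <= n)%N ->
      bsum f n (y k0) <= n%:R * (mean p f + k.+1%:R^-1)].
  have [||U [N UN]] := @upper_lln_fixed f k.+1%:R^-1 (eta / (2 ^ k.+1)%:R).
  - by rewrite invr_gt0.
  - by rewrite divr_gt0// ltr0n expn_gt0.
  - by exists (U, N).
have [UN UNP] := choice H.
exists (\bigcup_k (UN k).1); split.
- by apply: bigcup_measurable => k _; have [] := UNP k.
- apply: le_trans (measure_sigma_subadditive (F := fun k => (UN k).1) _ _ _ _) _ => //.
  + by move=> k; have [] := UNP k.
  + by apply: bigcup_measurable => k _; have [] := UNP k.
  apply: le_trans (epsilon_trick0 xpredT (ltW eta0)).
  by apply: lee_nneseries => // k _; have [] := UNP k.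
- move=> e e0; have [k ke] : exists k, k.+1%:R^-1 < e.
    by have [k _ /(_ k (leqnn k))] := near_infty_natSinv_lt (PosNum e0); exists k.
  exists (UN k).2 => y n nU Nn; have [_ _ bnd] := UNP k.
  apply: le_trans (bnd y n _ Nn) _; first by move=> yU; apply: nU; exists k.
  by apply: ler_wpM2l => //; rewrite lerD2l ltW.
Qed.

(** Two-sided bounds come from [upper_lln] for [f i] and its negative, the Boolean choosing the
    sign; the finitely many exceptional sets are united. *)
Lemma lln_family (I : finType) (f : I -> alph m -> R) (eta : R) : 0 < eta ->
  exists U : set (conf_mes r m), [/\ measurable U, (mu U <= eta%:E)%E &
    forall e : R, 0 < e -> exists N : nat, forall i y n, ~ U y -> (N <= n)%N ->
      `|bsum (f i) n (y k0) - n%:R * mean p (f i)| <= n%:R * e].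
Proof.
move=> eta0; pose J := (I * bool)%type.
pose h (ib : J) : alph m -> R := fun j => (-1) ^+ ib.2 * f ib.1 j.
pose d := eta / (#|{: J}|.+1)%:R.
have d0 : 0 < d by rewrite divr_gt0.
have [U UP] := choice (fun ib => upper_lln (h ib) d0).
have bsumh b i n x : bsum (h (i, b)) n x = (-1) ^+ b * bsum (f i) n x.
  by rewrite /bsum mulr_sumr.
have meanh b i : mean p (h (i, b)) = (-1) ^+ b * mean p (f i).
  by rewrite /mean mulr_sumr; apply: eq_bigr => j _; rewrite mulrA.
exists (\big[setU/set0]_(ib : J) U ib); split.
- by apply: bigsetU_measurable => ib _; have [] := UP ib.
- apply: (@le_trans _ _ (\sum_(ib : J) d%:E)%E).
    by apply: measure_bigsetU_le => ib _; have [] := UP ib.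
  rewrite sumEFin lee_fin sumr_const -[_ *+ _]mulr_natl /d mulrCA.
  by rewrite ler_piMr ?(ltW eta0)// ler_pdivrMr// mul1r ler_nat.
- move=> e e0.
  have [N NP] := choice (fun ib => let: And3 _ _ h := UP ib in h e e0).
  exists (\max_ib N ib)%N => i y n nU Nn.
  have bnd ib : bsum (h ib) n (y k0) <= n%:R * (mean p (h ib) + e).
    apply: NP; last by apply: leq_trans Nn; exact: leq_bigmax.
    by move=> yU; apply: nU; rewrite -bigcup_seq; exists ib => //=; rewrite mem_index_enum.
  have := bnd (i, false); have := bnd (i, true).
  rewrite !bsumh !meanh expr0 expr1 !mul1r !mulN1r ler_norml.
  by move: (bsum _ _ _) (mean _ _) => a b; lra.
Qed.

End LawOfLargeNumbers.

(** * Bowen balls and cylinders *)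

Section BowenBalls.
Variables (R : realType) (m : nat).
Implicit Types (x y : seqs m).

Lemma iter_shiftE j x i : iter j (@Defs.shift m) x i = x (i + j)%N.
Proof. by elim: j i => [|j ih] i; rewrite ?addn0// iterS /Defs.shift ih addnS. Qed.

Lemma dist_lt1 x y : dist R x y < 1 -> x 0%N = y 0%N.
Proof.
rewrite /dist; case: pselect => [H|nH] lt1; last first.
  by apply/eqP/negPn/negP => ne; apply: nH; exists 0%N.
case: ex_minnP lt1 => -[|k] ne kmin; first by rewrite expr0 invr1 ltxx.
by move=> _; apply/eqP/negPn/negP => /kmin.
Qed.

Lemma dist_agree T x y : (0 < m)%N -> (forall i, (i < T)%N -> x i = y i) ->
  dist R x y <= m%:R ^- T.
Proof.
move=> m0 xy; rewrite /dist; case: pselect => [H|_]; last first.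
  by rewrite invr_ge0 exprn_ge0.
case: ex_minnP => k ne _.
have Tk : (T <= k)%N by rewrite leqNgt; apply/negP => /xy /eqP; exact/negP.
by rewrite lef_pV2 ?posrE ?exprn_gt0 ?ltr0n// ler_weXn2l// ler1n.
Qed.

(** Sequences differing at coordinate 0 are at distance 1, so radius 1 already places the ball
    inside a cylinder of length [k]; the lower bound works at this radius. *)
Lemma bowen_ball1_agree k x y i : bowen_ball k x (1 : R) y -> (i < k)%N -> x i = y i.
Proof.
rewrite /bowen_ball /= => lt1 ik.
have : dist R (iter i (@Defs.shift m) x) (iter i (@Defs.shift m) y) < 1.
  apply: le_lt_trans lt1.
  exact: (le_bigmax _ (fun j : 'I_k => dist R (iter j _ x) (iter j _ y)) (Ordinal ik)).
by move/dist_lt1; rewrite !iter_shiftE.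
Qed.

(** Each of the first [k] shifts must show [T] agreeing letters to be within [m%:R ^- T], hence the
    length [k + T]. *)
Lemma agree_bowen_ball T k x y (eps : R) : (0 < m)%N -> m%:R ^- T < eps ->
  (forall i, (i < k + T)%N -> x i = y i) -> bowen_ball k x eps y.
Proof.
move=> m0 Teps xy; rewrite /bowen_ball /=; apply: bigmax_lt => [|j _].
  by apply: le_lt_trans Teps; rewrite invr_ge0 exprn_ge0.
apply: le_lt_trans Teps; apply: dist_agree => // i iT.
by rewrite !iter_shiftE xy// (addnC k) -addSn leq_add// ltnW.
Qed.

End BowenBalls.

(** * Lower bound *)

Lemma ElevelE (R : realType) (r m : nat) (phi : 'I_r -> alph m -> R) (alpha : R)
    (x : seqs m) : Elevel phi alpha x =
  ((fun n => \prod_(k < r) (n%:R^-1 * bsum (phi k) n x)) @ \oo --> alpha).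
Proof.
rewrite /Elevel /=; congr (_ --> alpha); congr (_ @ \oo); apply/funext => n.
rewrite big_split /= prodr_const card_ord exprVn; congr (_ * _).
rewrite bigA_distr_bigA /=; apply: eq_bigr => i _; apply: eq_bigr => k _.
by congr (phi k _); exact: (iter_shiftE (i k).+1 x 0).
Qed.

Lemma mean_ln (R : realType) (m : nat) (p : alph m -> R) :
  mean p (fun j => ln (p j)) = - H1 p.
Proof. by rewrite /H1 opprK; apply: eq_bigr => j _; rewrite mulrC. Qed.

(** Not an equality, for two reasons: the factor [p (x 0)], skipped by [bsum], is at most 1, and a
    letter of probability 0 contributes [expR (ln 0) = 1] on the right. *)
Lemma prod_le_expR_bsum (R : realType) (m : nat) (p : alph m -> R) n
    (x : seqs m) : probvec p ->
  \prod_(i < n.+1) p (x i) <= expR (bsum (fun j => ln (p j)) n x).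
Proof.
move=> [p0 p1]; rewrite big_ord_recl /=.
have le1 j : p j <= 1 by rewrite -p1 (bigD1 j)//= lerDl sumr_ge0.
apply: (@le_trans _ _ (\prod_(i < n) p (x i.+1))).
  by rewrite ler_piMl// prodr_ge0.
rewrite /bsum expR_sum; apply: ler_prod => i _; rewrite p0 /=.
have [px0|px0] := ltP 0 (p (x i.+1)); first by rewrite lnK.
by apply: le_trans px0 _; exact: expR_ge0.
Qed.

Lemma htop_Elevel_ge (R : realType) (r m : nat) (k0 : 'I_r)
    (phi : 'I_r -> alph m -> R) (p : alph m -> R)
    (mu : {measure set (conf_mes r m) -> \bar R}) :
  probvec p -> bernoulli_prod p mu ->
  ((H1 p)%:E <= htop R (Elevel phi (level phi p)))%E.
Proof.
move=> pP mup; set E := Elevel _ _.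
apply: (@le_trans _ _ (htop_eps E (1 : R))); last first.
  by apply: ereal_sup_ubound; exists 1 => //=.
apply: le_ereal_inf_tmp => _ [s /= Hs <-]; rewrite lee_fin leNgt; apply/negP => sH.
(* The slot [None] holds [ln p], of mean [- H1 p]: a single exceptional set then serves both
   membership in [E] and the mass of cylinders. *)
pose f (o : option 'I_r) := if o is Some k then phi k else fun j => ln (p j).
have [|U [mU muU lln]] := lln_family k0 pP mup f (eta := 1/4); first by lra.
have [|N Nlln] := lln ((H1 p - s) / 2); first lra.
(* For [k >= K] the law of large numbers applies at [k.-1], coordinate 0 not being summed. The
   second bound says [s * k <= (k - 1) * (H1 p + s) / 2], which absorbs that lost coordinate. *)
pose K := maxn N.+1 (Num.bound `|(H1 p + s) / (H1 p - s)|).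
have [c [cK cE] csum] : exists2 c, is_cover E (1 : R) K c &
    (\sum_(0 <= i <oo) cover_term s (c i) < (1/2)%:E)%E.
  have : (bowenH_n E (1 : R) s K < (1/2)%:E)%E.
    apply: (@le_lt_trans _ _ 0%E); last by rewrite lte_fin; lra.
    by rewrite -Hs; apply: ereal_sup_ubound; exists K.
  by move=> /ereal_inf_lt[_ [c cc <-] lt]; exists c.
(* A cylinder in row [k0], encoded by 0-1 factors so that [bernoulli_markov] bounds its mass. *)
pose S (x : seqs m) (k : nat) : set (conf_mes r m) :=
  [set y : conf r m | 1 <= \prod_(i < k) (y k0 i == x i)%:R :> R].
have SP x k (y : conf_mes r m) : S x k y <-> forall i, (i < k)%N -> y k0 i = x i.
  rewrite /S /=; split=> [+ i ik|yx]; last by rewrite big1// => i _; rewrite yx ?eqxx.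
  apply: contraTeq => ne; rewrite (bigD1 (Ordinal ik))//= (negPf ne) mul0r.
  by rewrite -ltNge ltr01.
have Smu x k : measurable (S x k) /\ (mu (S x k) <= (\prod_(i < k) p (x i))%:E)%E.
  have [//|mS b] := @bernoulli_markov _ _ _ _ _ pP mup k0 k
    (fun i j => (j == x i)%:R).
  rewrite -/(S x k) in mS *; split=> //; apply: le_trans b _; rewrite lee_fin.
  rewrite le_eqVlt; apply/orP; left; apply/eqP; apply: eq_bigr => i _.
  rewrite (bigD1 (x i))//= eqxx mulr1 big1 ?addr0// => j /negPf ->.
  by rewrite mulr0.
pose D i : set (conf_mes r m) := if c i is Some (x, k) then S x k else set0.
(* Cylinders inside [U] are discarded. Any other contains a point off [U], whose letter averages
   bound the mass of the cylinder by the weight of its ball. *)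
pose D' i := if `[< D i `<=` U >] then set0 else D i.
have D'mu i : measurable (D' i) /\ (mu (D' i) <= cover_term s (c i))%E.
  rewrite /D'; case: asboolP => [_|/existsNP[y /not_implyP[]]].
    by rewrite measure0; split=> //; case: (c i) => [[]|]//= *; rewrite lee_fin expR_ge0.
  rewrite /D; case ci: (c i) => [[x k]|]//= Sy nUy; have [mS muS] := Smu x k.
  split=> //; apply: le_trans muS _; rewrite lee_fin.
  have Kk := cK _ _ _ ci.
  move/SP: Sy => yx.
  have -> : \prod_(i < k) p (x i) = \prod_(i < k) p (y k0 i).
    by apply: eq_bigr => l _; rewrite yx.
  have : (N < k)%N by apply: leq_trans Kk; rewrite leq_max leqnn.
  have : (H1 p + s) / (H1 p - s) <= k%:R.
    apply: le_trans (ler_norm _) _; apply: ltW; apply: lt_le_trans (archi_boundP _) _ => //.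
    by rewrite ler_nat (leq_trans _ Kk)// leq_max leqnn orbT.
  case: {yx Kk ci} k {mS} => [//|k] kb Nk.
  apply: le_trans (prod_le_expR_bsum _ _ pP) _; rewrite ler_expR.
  have := Nlln None y k nUy Nk; rewrite /f mean_ln ler_norml => /andP[_ bk].
  rewrite ler_pdivrMr ?subr_gt0// in kb; rewrite -natr1 in kb *.
  by move: bk kb; move: (bsum _ _ _) (H1 p) (k%:R : R) => b h q; nra.
(* [U] has mass at most 1/4 and the remaining cylinders less than 1/2, out of a total of 1. *)
have [y yU yD] : exists2 y, ~ U y & forall i, ~ D' i y.
  apply: contrapT => H.
  have sub : [set: conf_mes r m] `<=` U `|` \bigcup_i D' i.
    move=> y _; have [|nU] := pselect (U y); first by left.
    right; apply: contrapT => nD; apply: H; exists y => // i Di.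
    by apply: nD; exists i.
  have mD : measurable (\bigcup_i D' i).
    by apply: bigcup_measurable => i _; have [] := D'mu i.
  have : (mu setT <= mu U + mu (\bigcup_i D' i))%E.
    apply: le_trans (measureU2 _ mU mD); apply: le_measure => //; rewrite inE//.
    exact: measurableU.
  rewrite (bernoulli_setT mup) leNgt => /negP; apply.
  apply: (@le_lt_trans _ _ ((1/4)%:E + (1/2)%:E)%E); last by rewrite -EFinD lte_fin; lra.
  apply: leeD => //; apply: le_trans (ltW csum).
  apply: le_trans (measure_sigma_subadditive (F := D') _ _ mD _) _ => //.
    by move=> i; have [] := D'mu i.
  by apply: lee_nneseries => // i _; have [] := D'mu i.
have yE : E (y k0).
  rewrite /E ElevelE; apply: cvg_bigprod => k; apply/cvgrPdist_le => e e0.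
  have [M Mlln] := lln e e0; exists M.+1 => // n /= Mn.
  have n0 : 0 < n%:R :> R by rewrite ltr0n (leq_trans _ Mn).
  have := Mlln (Some k) y n yU (ltnW Mn); rewrite /f => bnd.
  rewrite -(ler_pM2l n0) -[X in X * `|_|](gtr0_norm n0) -normrM mulrBr mulVKf ?gt_eqF//.
  by rewrite distrC.
have [i _] := cE _ yE; case ci: (c i) => [[x k]|]//= ball.
have Dy : D i y.
  rewrite /D ci; apply/SP => l lk; apply/esym; exact: bowen_ball1_agree ball lk.
by apply: (yD i); rewrite /D'; case: asboolP => [DU|//]; apply: yU; exact: DU.
Qed.

(** * Empirical frequencies and counting of words *)

(** Covers are indexed by [nat]; numbers that code no element decode to [None] and contribute 0. *)
Lemma esum_pickle (R : realType) (S : countType) (a : S -> \bar R) :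
  (forall k, 0 <= a k)%E ->
  \esum_(i in [set: nat]) oapp a 0%E (pickle_inv i) = \esum_(k in [set: S]) a k.
Proof.
move=> a0; pose F i := oapp a 0%E (@pickle_inv S i).
have Fpickle k : F (pickle k) = a k by rewrite /F pickleK_inv.
transitivity (\esum_(i in range (@pickle S)) F i).
  rewrite [RHS]esum_mkcond; apply: eq_esum => i _; case: ifPn => //.
  rewrite notin_setE /F => ni; case e: (pickle_inv i) => [k|] //=.
  by exfalso; apply: ni; exists k => //; have := @pickle_invK S i; rewrite e.
rewrite (@reindex_esum _ _ _ setT _ (@pickle S)); first exact: eq_esum.
by apply: inj_bij => k l _ _; exact: (pcan_inj (@pickleK_inv S)).
Qed.

Section Frequencies.
Variables (R : realType) (m : nat).
Implicit Types (x : seqs m) (n : nat).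

Definition visits n x (j : alph m) : nat := (\sum_(i < n) (x i.+1 == j))%N.

Definition freq n x (j : alph m) : R := n%:R^-1 * (visits n x j)%:R.

Lemma visits_le n x j : (visits n x j <= n)%N.
Proof.
rewrite -[leqRHS]muln1 -[X in (X * 1)%N]card_ord -sum_nat_const.
by apply: leq_sum => i _; exact: leq_b1.
Qed.

Lemma sum_visits n x : (\sum_j visits n x j = n)%N.
Proof.
rewrite exchange_big /= -[RHS]muln1 -[X in (X * 1)%N]card_ord -sum_nat_const.
apply: eq_bigr => i _; rewrite (bigD1 (x i.+1))//= eqxx big1// => j.
by rewrite eq_sym => /negPf ->.
Qed.

Lemma probvec_freq n x : (0 < n)%N -> probvec (freq n x).
Proof.
move=> n0; split=> [j|]; first by rewrite mulr_ge0// invr_ge0.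
by rewrite -mulr_sumr -natr_sum sum_visits mulVf// pnatr_eq0 -lt0n.
Qed.

Lemma mean_freq n x (f : alph m -> R) : mean (freq n x) f = n%:R^-1 * bsum f n x.
Proof.
transitivity (n%:R^-1 * \sum_j \sum_(i < n) f j * (x i.+1 == j)%:R).
  rewrite mulr_sumr; apply: eq_bigr => j _.
  by rewrite /freq /visits natr_sum -mulr_sumr mulrCA.
congr (_ * _); rewrite exchange_big; apply: eq_bigr => i _ /=.
rewrite (bigD1 (x i.+1))//= eqxx mulr1 big1 ?addr0// => j.
by rewrite eq_sym => /negPf ->; rewrite mulr0.
Qed.

(** This is [mean_ln] for the frequency vector: the letters read all occur, so their frequencies are
    positive and [expR] cancels [ln]. *)
Lemma prod_freq n x : (0 < n)%N ->
  \prod_(i < n) freq n x (x i.+1) = expR (- (n%:R * H1 (freq n x))).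
Proof.
move=> n0; rewrite -mulrN -mean_ln mean_freq mulVKf ?pnatr_eq0 -?lt0n//.
rewrite /bsum expR_sum; apply: eq_bigr => i _; rewrite lnK// posrE.
by rewrite mulr_gt0 ?invr_gt0 ?ltr0n// /visits (bigD1 i)//= eqxx.
Qed.

End Frequencies.

Section UpperBound.
Variables (R : realType) (m : nat).

(** In a word of length [(n + T).+1] the frequencies read the window 1 to [n]; coordinate 0 and the
    last [T] are free, whence the exponent [T.+1]. *)
Lemma prod_window (n T : nat) (a : nat -> R) (b : R) :
  \prod_(i < (n + T).+1) (if (0 < i <= n)%N then a i else b) =
  (\prod_(i < n) a i.+1) * b ^+ T.+1.
Proof.
rewrite big_ord_recl /= exprS mulrCA; congr (_ * _); rewrite big_split_ord /=.
congr (_ * _).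
  by apply: eq_bigr => i _; rewrite /bump /= add1n ltn_ord.
rewrite (eq_bigr (fun=> b)) ?prodr_const ?card_ord// => i _.
by rewrite /bump /= add1n ltnNge leq_addr.
Qed.

Definition ext (n : nat) (v : {ffun 'I_n -> alph m}) : seqs m :=
  fun i => if insub i is Some j then v j else ord0.

Lemma extE n (v : {ffun 'I_n -> alph m}) (i : 'I_n) : ext v i = v i.
Proof. by rewrite /ext; case: insubP => [j _ /val_inj ->//|]; rewrite ltn_ord. Qed.

Lemma ext_restr n (x : seqs m) i : (i < n)%N ->
  ext [ffun j : 'I_n => x j] i = x i.
Proof. by move=> i_n; rewrite (extE _ (Ordinal i_n)) ffunE. Qed.

(* Method of types: the word [v] has probability [exp (- n H)] under its own
   frequency vector, each vector [tau / n] gives total mass [#|alph|^(T+1)] to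
   the words, and there are at most [(n+1)^#|alph|] such vectors. *)
Lemma sum_expR_entropy (n T : nat) : (0 < n)%N ->
  \sum_(v : {ffun 'I_(n + T).+1 -> alph m})
    expR (- (n%:R * H1 (freq R n (ext v)))) <=
  #|alph m|%:R ^+ T.+1 * n.+1%:R ^+ #|alph m|.
Proof.
move=> n0; pose typ := {ffun alph m -> 'I_n.+1}.
pose q (tau : typ) j : R := n%:R^-1 * (tau j : nat)%:R.
pose P (tau : typ) := (\sum_j (tau j : nat) == n)%N.
pose mass (tau : typ) (x : seqs m) := \prod_(i < n) q tau (x i.+1).
have mass0 tau x : 0 <= mass tau x.
  by apply: prodr_ge0 => i _; rewrite mulr_ge0// invr_ge0.
apply: (@le_trans _ _ (\sum_(v : {ffun 'I_(n + T).+1 -> alph m})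
    \sum_(tau | P tau) mass tau (ext v))).
  apply: ler_sum => v _; rewrite -prod_freq//.
  pose tau : typ := [ffun j => inord (visits n (ext v) j)].
  have tauE j : tau j = visits n (ext v) j :> nat.
    by rewrite ffunE inordK// ltnS visits_le.
  rewrite (bigD1 tau) /=; last first.
    by rewrite /P (eq_bigr (visits n (ext v))) ?sum_visits.
  rewrite -[leLHS]addr0 lerD ?sumr_ge0// le_eqVlt; apply/orP; left; apply/eqP.
  by apply: eq_bigr => i _; rewrite /q tauE.
rewrite exchange_big /=.
apply: (@le_trans _ _ (\sum_(tau | P tau) #|alph m|%:R ^+ T.+1)); last first.
  rewrite sumr_const -[leLHS]mulr_natr; apply: ler_wpM2l; first exact: exprn_ge0.
  rewrite -natrX ler_nat; apply: leq_trans (max_card _) _.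
  by rewrite card_ffun card_ord.
apply: ler_sum => tau /eqP tauP; rewrite le_eqVlt; apply/orP; left; apply/eqP.
(* Factor 1 outside the window lets the sum over words factor: a window coordinate sums to 1 because
   [tau] sums to [n], a free one to [#|alph m|]. *)
pose F (i : 'I_(n + T).+1) j := if (0 < i <= n)%N then q tau j else 1.
transitivity (\sum_(v : {ffun 'I_(n + T).+1 -> alph m}) \prod_i F i (v i)).
  apply: eq_bigr => v _.
  rewrite /mass -[LHS]mulr1 -[X in _ * X](expr1n _ T.+1).
  rewrite -(prod_window n T (fun i => q tau (ext v i)) 1).
  by apply: eq_bigr => i _; rewrite /F extE.
rewrite -(bigA_distr_bigA F).
transitivity (\prod_(i < (n + T).+1)
    (if (0 < i <= n)%N then (fun=> 1) (i : nat) else #|alph m|%:R : R)).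
  apply: eq_bigr => i _; rewrite /F; case: ifP => _.
    by rewrite -mulr_sumr -natr_sum tauP mulVf// pnatr_eq0 -lt0n.
  by rewrite sumr_const.
by rewrite (prod_window n T (fun=> 1)) big1// mul1r.
Qed.

(** Raise [y <= expR y] at [y = c * n.+1%:R] to the power [d]. The choice of [c] gives
    [d * c <= eta], and [d.+1] keeps it meaningful for [d = 0]. *)
Lemma natX_le_expR (d : nat) (eta : R) : 0 < eta ->
  exists2 C : R, 0 < C & forall n, n.+1%:R ^+ d <= C * expR (n%:R * eta).
Proof.
move=> eta0; pose c := eta / d.+1%:R.
have c0 : 0 < c by rewrite divr_gt0.
exists ((c^-1 * expR c) ^+ d); first by rewrite exprn_gt0// mulr_gt0 ?invr_gt0 ?expR_gt0.
move=> n; apply: (@le_trans _ _ ((c^-1 * expR (c * n.+1%:R)) ^+ d)).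
  apply: lerXn2r; rewrite ?nnegrE ?mulr_ge0 ?invr_ge0 ?expR_ge0 ?(ltW c0)//.
  rewrite ler_pdivlMl//; apply: le_trans (expR_ge1Dx _); lra.
have -> : c * n.+1%:R = c + c * n%:R by rewrite -natr1; ring.
rewrite expRD mulrA exprMn ler_pM2l; last first.
  by rewrite exprn_gt0// mulr_gt0 ?invr_gt0 ?expR_gt0.
rewrite -expRM_natl ler_expR mulrA [n%:R * eta]mulrC; apply: ler_wpM2r => //.
by rewrite /c mulrCA ler_piMr ?(ltW eta0)// ler_pdivrMr// mul1r ler_nat.
Qed.

End UpperBound.

(** * Covers of the level set and the upper bound *)

Lemma level_freq (R : realType) (r m : nat) (phi : 'I_r -> alph m -> R) n
    (x : seqs m) :
  level phi (freq R n x) = \prod_(k < r) (n%:R^-1 * bsum (phi k) n x).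
Proof. by apply: eq_bigr => k _; rewrite mean_freq. Qed.

Lemma Elevel_near (R : realType) (r m : nat) (phi : 'I_r -> alph m -> R)
    (alpha d : R) (x : seqs m) : Elevel phi alpha x -> 0 < d ->
  exists M, forall n, (M <= n)%N -> `|level phi (freq R n x) - alpha| < d.
Proof.
rewrite ElevelE => /cvgrPdist_lt xa d0; have [M _ MP] := xa d d0.
by exists M => n /MP; rewrite level_freq distrC.
Qed.

(** At length [L = N + n] a retained word with frequency vector [q] weighs at most
    [expR (- eta * L) * expR (- L * H1 q)]. The last factors sum to a polynomial in [L], absorbed by
    half of the decay, which leaves [theta ^+ L]. *)
Lemma Elevel_cover (R : realType) (r m : nat) (phi : 'I_r -> alph m -> R)
    (alpha h eta d eps : R) : (1 < m)%N -> 0 < eta -> 0 < d -> 0 < eps ->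
  (forall q, probvec q -> `|level phi q - alpha| < d -> H1 q < h + eta) ->
  exists C theta : R, [/\ 0 <= C, `|theta| < 1 & forall N, (0 < N)%N ->
    exists2 c, is_cover (Elevel phi alpha) eps N c &
      (\sum_(0 <= i <oo) cover_term (h + eta + eta) (c i) <= (C * theta ^+ N)%:E)%E].
Proof.
move=> m1 eta0 d0 eps0 Hlt; have m0 : (0 < m)%N by exact: ltn_trans m1.
(* With [T.+1] in place of [T], the words reach coordinate [N + n], the last one that [freq]
   reads. *)
have [T Teps] : exists T, m%:R ^- T.+1 < eps.
  have mi : `|m%:R^-1 : R| < 1 by rewrite ger0_norm ?invr_ge0// invf_lt1 ?ltr1n// ltr0n.
  have [T _ /(_ T.+1 (leqnSn T))] := (cvgr0Pnorm_lt _).1 (@cvg_geometric R 1 _ mi) _ eps0.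
  rewrite /= mul1r ger0_norm ?exprn_ge0 ?invr_ge0// exprVn => Tlt.
  by exists T.
have eta2 : 0 < eta / 2 by rewrite divr_gt0.
have [C0 C00 C0P] := natX_le_expR #|alph m| eta2.
pose theta := expR (- (eta / 2)).
pose C1 := #|alph m|%:R ^+ T.+1 * C0.
have C10 : 0 <= C1 by rewrite mulr_ge0 ?exprn_ge0 ?(ltW C00).
have th0 : 0 < theta by exact: expR_gt0.
have th1 : theta < 1 by rewrite expR_lt1 oppr_lt0.
have nth1 : `|theta| < 1 by rewrite gtr0_norm.
exists (C1 / (1 - theta)), theta; split => //.
  by rewrite divr_ge0// subr_ge0 ltW.
move=> N N0; pose W n := {ffun 'I_(N + n + T).+1 -> alph m}.
pose good n (v : W n) := `|level phi (freq R (N + n) (ext v)) - alpha| < d.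
pose ball n (v : W n) : option (seqs m * nat) :=
  if good n v then Some (ext v, N + n)%N else None.
(* Decoding has two stages: the first entry of the pair fixes the word length, hence the type in
   which the second is decoded. *)
pose dec (k : nat * nat) := obind (@ball k.1) (@pickle_inv (W k.1) k.2).
pose c i := obind dec (@pickle_inv (nat * nat)%type i).
exists c.
  split.
    move=> i x k; rewrite /c; case: pickle_inv => [[n j]|]//=.
    rewrite /dec /=; case: pickle_inv => [v|]//=; rewrite /ball.
    by case: ifP => // _ [_ <-]; exact: leq_addr.
  (* A point is caught at length [N + M], where [M] is a time from which its level stays [d]-close
     to [alpha]. *)
  move=> x Ex; have [M MP] := Elevel_near Ex d0.
  pose v : W M := [ffun j : 'I_(N + M + T).+1 => x j].
  have vx i : (i < (N + M + T).+1)%N -> ext v i = x i by exact: ext_restr.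
  exists (pickle (M, pickle v)) => //; rewrite /c pickleK_inv /= /dec pickleK_inv /=.
  have -> : ball M v = Some (ext v, N + M)%N.
    rewrite /ball /good; suff -> : freq R (N + M) (ext v) = freq R (N + M) x.
      by rewrite MP// leq_addl.
    apply/funext => j; rewrite /freq /visits; congr (_ * _%:R).
    by apply: eq_bigr => i _; rewrite vx// !ltnS (leq_trans (ltn_ord i))// leq_addr.
  apply: (agree_bowen_ball m0 Teps) => i; rewrite addnS; exact: vx.
set s := h + eta + eta.
have ct0 (o : option (seqs m * nat)) : (0 <= cover_term s o)%E.
  by case: o => [[x k]|]//=; rewrite lee_fin expR_ge0.
have obindE (S : Type) (g : S -> option (seqs m * nat)) o :
  cover_term s (obind g o) = oapp (fun k => cover_term s (g k)) 0%E o by case: o.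
have level_sum n : \esum_(j in [set: nat]) cover_term s (dec (n, j)) =
    (\sum_(v : W n | good n v) expR (- (s * (N + n)%:R)))%:E.
  rewrite /dec /=; under eq_esum do rewrite obindE.
  rewrite esum_pickle// esum_fset//; last exact: finite_finset.
  rewrite (fsbigE (index_enum (W n))) ?index_enum_uniq//; last first.
    by move=> v _; rewrite mem_index_enum.
  rewrite -sumEFin [RHS]big_mkcond; apply: eq_big => [v|v _]; first exact: in_setT.
  by rewrite /ball; case: ifP.
rewrite nneseries_esumT//.
under eq_esum do rewrite obindE.
rewrite esum_pickle//.
have -> : [set: nat * nat] = [set: nat] `*`` (fun=> [set: nat]) by apply/seteqP; split.
rewrite -(esum_esum (a := fun n j => cover_term s (dec (n, j))))//.
under eq_esum do rewrite level_sum.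
rewrite -nneseries_esumT; last by move=> n; rewrite lee_fin sumr_ge0// => *; exact: expR_ge0.
apply: nneseries_le => [n|K]; first by rewrite lee_fin sumr_ge0// => *; exact: expR_ge0.
apply: (@le_trans _ _ (\sum_(0 <= n < K) (C1 * theta ^+ N * theta ^+ n)%:E)%E); last first.
  rewrite sumEFin lee_fin (mulrAC C1 _ (theta ^+ N)).
  by apply: (@geometric_le_lim _ K (C1 * theta ^+ N) theta) => //;
    rewrite mulr_ge0// exprn_ge0// ltW.
apply: lee_sum => n _; rewrite lee_fin.
have Nn0 : (0 < N + n)%N by rewrite addn_gt0 N0.
apply: (@le_trans _ _ (expR (- (eta * (N + n)%:R)) * \sum_(v : W n)
    expR (- ((N + n)%:R * H1 (freq R (N + n) (ext v)))))).
  rewrite mulr_sumr [leRHS](bigID (good n))/= -[leLHS]addr0 lerD//; last first.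
    by rewrite sumr_ge0// => v _; rewrite mulr_ge0 ?expR_ge0.
  apply: ler_sum => v gv; rewrite -expRD ler_expR.
  have := Hlt _ (probvec_freq R _ Nn0) gv.
  have : 0 < (N + n)%:R :> R by rewrite ltr0n.
  by move: (H1 _) (_%:R) => H q; rewrite /s; nra.
apply: le_trans (ler_wpM2l (expR_ge0 _) (sum_expR_entropy _ _ T Nn0)) _.
rewrite -mulrA -exprD /C1 /theta mulrCA -mulrA; apply: ler_wpM2l; first exact: exprn_ge0.
apply: le_trans (ler_wpM2l (expR_ge0 _) (C0P (N + n)%N)) _.
rewrite mulrCA ler_pM2l// -expRD -expRM_natl ler_expR; lra.
Qed.

Lemma bowenH_ge0 (R : realType) (m : nat) (Z : set (seqs m)) (eps s : R) :
  (0 <= bowenH Z eps s)%E.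
Proof.
apply: le_ereal_sup_tmp; exists (bowenH_n Z eps s 0); first by exists 0%N.
apply: le_ereal_inf_tmp => _ [c _ <-]; apply: nneseries_ge0 => i _ _.
by case: (c i) => [[x k]|]//=; rewrite lee_fin expR_ge0.
Qed.

(** At exponent [h + e] the quantity [bowenH] vanishes: one half of [e] is entropy slack, the other
    pays for geometric decay, so the covers of [Elevel_cover] have weight tending to 0. *)
Lemma htop_Elevel_le (R : realType) (r m : nat) (phi : 'I_r -> alph m -> R)
    (alpha h : R) : (1 < m)%N ->
  (forall eta : R, 0 < eta -> exists2 d : R, 0 < d &
    forall q, probvec q -> `|level phi q - alpha| < d -> H1 q < h + eta) ->
  (htop R (Elevel phi alpha) <= h%:E)%E.
Proof.
move=> m1 Husc; apply: ge_ereal_sup => _ [eps /= eps0 <-].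
apply/lee_addgt0Pr => e e0; have e2 : 0 < e / 2 by rewrite divr_gt0.
have [d d0 Hlt] := Husc _ e2.
have [C [theta [C0 th1 cov]]] := Elevel_cover m1 e2 d0 eps0 Hlt.
apply: ereal_inf_lbound; exists (h + e / 2 + e / 2); last by rewrite -addrA -splitr EFinD.
apply/eqP; rewrite eq_le bowenH_ge0 andbT.
apply: ge_ereal_sup => _ [n _ <-]; apply/lee_addgt0Pr => e' e'0; rewrite add0e.
have [M _ MP] := (cvgr0Pnorm_le _).1 (@cvg_geometric R C _ th1) _ e'0.
pose N := maxn M n.+1.
have [c [cN cE] csum] := cov N (leq_trans (ltn0Sn n) (leq_maxr M n.+1)).
apply: ge_ereal_inf; exists (\sum_(0 <= i <oo) cover_term (h + e / 2 + e / 2) (c i))%E.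
  exists c => //; split=> // i x k /cN; apply: leq_trans.
  by rewrite ltnW// leq_maxr.
apply: le_trans csum _; rewrite lee_fin; apply: le_trans (ler_norm _) _.
by apply: MP; exact: leq_maxl.
Qed.

(** * Assembly of the integral formula and the two bounds *)

Theorem theorem5p3 (R : realType) (m r : nat) (hm : (1 < m)%N) (hr : (0 < r)%N)
  (phi : 'I_r -> alph m -> R)
  (mu : (alph m -> R) -> {measure set (conf_mes r m) -> \bar R})
  (hmu : forall p : alph m -> R, probvec p -> bernoulli_prod p (mu p)) :
  (forall p : alph m -> R, probvec p ->
     Aint phi (mu p) = (\prod_(k < r) \sum_(j : alph m) phi k j * p j)%:E)
  /\
  (forall alpha : R, Elevel phi alpha !=set0 ->
     exists p : alph m -> R,
       [/\ probvec p, Aint phi (mu p) = alpha%:E,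
           htop R (Elevel phi alpha) = (H1 p)%:E &
           forall q : alph m -> R, probvec q -> Aint phi (mu q) = alpha%:E ->
             H1 q <= H1 p]).
Proof.
have AintE p : probvec p -> Aint phi (mu p) = (level phi p)%:E.
  by move=> pP; exact: (Aint_level phi pP (hmu _ pP)).
split=> [p /AintE //|alpha [x xE]].
(* Nonemptiness enters here: long prefixes of [x] have frequency vectors with level near [alpha],
   and [M.+1] keeps the length positive. *)
have [|p [pP pa pmax pusc]] := @entropy_maximum R r m phi alpha.
  move=> d d0; have [M MP] := Elevel_near xE d0.
  by exists (freq R M.+1 x); [exact: probvec_freq|exact: MP].
exists p; split=> //.
- by rewrite AintE// pa.
- apply/eqP; rewrite eq_le htop_Elevel_le//= -pa.
  exact: (htop_Elevel_ge (Ordinal hr) phi pP (hmu _ pP)).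
- by move=> q qP; rewrite AintE// => -[qa]; exact: pmax.
Qed.
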